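(* Let $\mathcal{H}$ be a complex Hilbert space, $n\ge 1$, $T_i \in \mathcal{B}(\mathcal{H})$ for $i = 1, 2, \dots, n$, and $q \in \mathbb{C}$ with $|q|\le 1$. Then for every Orlicz function $\phi$, \begin{align*} \phi\left(w_q^2\left(\sum_{i=1}^{n}T_i \right) \right) \le \frac{1}{n}\sum_{i=1}^{n} \phi\left(n^2 \left( |q|^2w^2(T_i) +\left(1-|q|^2+|q|\sqrt{1-|q|^2}\right)\|T_i\|^2\right)\right). \end{align*}
   Context: $\mathcal{B}(\mathcal{H})$ is the $C^*$-algebra of all bounded linear operators on $\mathcal{H}$, with operator norm $\|\cdot\|$; the inner product is linear in its first argument. For $T\in\mathcal{B}(\mathcal{H})$, the numerical radius is $w(T)=\sup\{|\langle Tx,x\rangle| : x\in\mathcal{H},\ \|x\|=1\}$ and, for $|q|\le 1$, the $q$-numerical radius is $w_q(T)=\sup\{|\langle Tx,y\rangle| : x,y\in\mathcal{H},\ \|x\|=\|y\|=1,\ \langle x,y\rangle=q\}$; it is understood that this set is nonempty, i.e. $\dim\mathcal{H}\ge 1$ if $|q|=1$ and $\dim\mathcal{H}\ge 2$ if $|q|<1$. Here $w_q^2(T)=(w_q(T))^2$ and $w^2(T)=(w(T))^2$. An Orlicz function (non-degenerate) is a continuous, convex, increasing function $\phi:[0,\infty)\to[0,\infty)$ with $\phi(0)=0$, $\phi(t)>0$ for every $t>0$, and $\lim_{t\to\infty}\phi(t)=\infty$. *)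

(* Defs.v *)
From HB Require Import structures.
From mathcomp Require Import all_boot all_order all_algebra complex.
From mathcomp Require Import all_classical all_reals all_analysis.

Set Implicit Arguments.
Unset Strict Implicit.
Unset Printing Implicit Defensive.

Import Order.TTheory GRing.Theory Num.Theory.
Import numFieldNormedType.Exports.

Local Open Scope classical_set_scope.
Local Open Scope ring_scope.

(* A norm over [R[i]] takes its values in [R[i]], where it is a nonnegative
   real; suprema only exist in [R], so we read it there. For [V := R[i]] this
   is the modulus of a complex number. *)
Definition rnorm (R : realType) (V : normedZmodType R[i]) (x : V) : R :=
  complex.Re `|x|.

(* A complex Hilbert space is a complete normed space over [R[i]] together with
   a positive definite hermitian form, linear in its first argument, that
   induces the norm. *)
Definition induces_norm (R : realType) (H : completeNormedModType R[i])
    (dot : {dot H for Num.conj}) : Prop :=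
  forall x : H, dot x x = `|x| ^+ 2.

Section operators.
Context {R : realType} {H : completeNormedModType R[i]}.
Implicit Types (dot : {dot H for Num.conj}) (T : H -> H) (q : R[i]).

Definition bounded_operator T : Prop :=
  exists M : R, forall x : H, rnorm (T x) <= M * rnorm x.

Definition opnorm T : R :=
  sup [set rnorm (T x) | x in [set x : H | rnorm x <= 1]].

Definition numerical_radius dot T : R :=
  sup [set rnorm (dot (T x) x) | x in [set x : H | rnorm x = 1]].

Definition q_values dot q T : set R :=
  [set rnorm (dot (T z.1) z.2) | z in
    [set z : H * H | [/\ rnorm z.1 = 1, rnorm z.2 = 1 & dot z.1 z.2 = q]]].

Definition q_numerical_radius dot q T : R := sup (q_values dot q T).

End operators.

(* Only the values of [phi] on [0, +oo) matter. Monotonicity is stated in the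
   weak form; together with convexity, [phi 0 = 0] and positivity it amounts to
   strict monotonicity on [0, +oo). *)
Record orlicz (R : realType) (phi : R -> R) : Prop := Orlicz {
  orlicz_ge0 : forall t : R, 0 <= t -> 0 <= phi t ;
  orlicz_continuous : {within `[0, +oo[, continuous phi} ;
  orlicz_convex : convex_function (`[0, +oo[%classic : set R) phi ;
  orlicz_increasing : forall s t : R, 0 <= s -> s <= t -> phi s <= phi t ;
  orlicz_0 : phi 0 = 0 ;
  orlicz_gt0 : forall t : R, 0 < t -> 0 < phi t ;
  orlicz_lim : phi t @[t --> +oo] --> +oo }.

(* Main.v *)
Require Import Defs.
From HB Require Import structures.
From mathcomp Require Import all_boot all_order all_algebra complex.
From mathcomp Require Import all_classical all_reals all_analysis.
From mathcomp Require Import ring lra.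

Set Implicit Arguments.
Unset Strict Implicit.
Unset Printing Implicit Defensive.

Import Order.TTheory GRing.Theory Num.Theory.
Import numFieldNormedType.Exports.

Local Open Scope classical_set_scope.
Local Open Scope ring_scope.

(** Given unit vectors [x], [y] with [dot x y = q] and an operator [T], split
    [T x] into its component [dot (T x) x *: x] along [x] and the orthogonal
    rest [r].  The first component pairs with [y] to [q * dot (T x) x]; the
    rest only sees the part of [y] orthogonal to [x], whose norm is
    [s = sqrt (1 - |q|^2)].  So, writing [a] for the modulus of [dot (T x) x]
    and [b] for the norm of [r],

      |dot (T x) y| <= |q| a + s b    with    a^2 + b^2 = ||T x||^2.

    Squaring and using [2 a b <= a^2 + b^2] gives

      |dot (T x) y|^2 <= |q|^2 a^2 + (s^2 + |q| s) ||T x||^2,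

    and [a] and [||T x||] are at most the numerical radius and the norm of [T].
    This is [rnorm_dot_operator_sqr_le], which rests on the two-component form
    [dot_CauchySchwarz_orthogonal] of the Cauchy-Schwarz inequality.

    For a sum of [n] operators the triangle inequality and the convexity of
    the square bound [|dot (sum_i T_i x) y|^2] by [n] times the sum of the
    individual bounds [C i], that is by the mean of the [n^2 C i].  As [x], [y]
    vary, the same bound holds for the square of the q-numerical radius, and
    Jensen's inequality moves the monotone convex function [phi] inside the
    mean.  Both convexity steps are instances of [jensen_mean]. *)

(** * Cauchy-Schwarz inequalities for positive definite forms *)

Section dot_products.
Context {C : numClosedFieldType} {U : lmodType C}.
Context (dot : {dot U for Num.conj}).
Implicit Types u v w x y : U.

Lemma dot_sub_proj u v : dot v v != 0 ->
  dot (u - (dot u v / dot v v) *: v) v = 0.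
Proof. by move=> v0; rewrite linearBl/= linearZl_LR/= divfK// subrr. Qed.

Lemma dnorm_sub_proj u v : dot v v != 0 ->
  let r := u - (dot u v / dot v v) *: v in
  dot r r = dot u u - `|dot u v| ^+ 2 / dot v v.
Proof.
move=> v0 /=; set a := _ / _; set r := u - _.
have rv : dot r (a *: v) = 0 by rewrite linearZr_LR/= dot_sub_proj// mulr0.
have -> : dot u u = dot r r + dot (a *: v) (a *: v).
  by rewrite -(hnormDd rv) subrK.
rewrite dnormZ.
have -> : `|a| ^+ 2 * dot v v = `|dot u v| ^+ 2 / dot v v.
  rewrite normrM normfV (ger0_norm (dnorm_ge0 dot v)) exprMn exprVn -mulrA.
  by rewrite expr2 invfM mulfVK.
by rewrite addrK.
Qed.

(** The gap is [dot v v] times the square norm of the component of [u]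
    orthogonal to [v]. *)
Lemma dot_CauchySchwarz u v : `|dot u v| ^+ 2 <= dot u u * dot v v.
Proof.
have [->|v0] := eqVneq v 0.
  by rewrite !linear0r normr0 expr0n.
have vv : 0 < dot v v by rewrite dnorm_gt0.
by rewrite -ler_pdivrMr// -subr_ge0 -dnorm_sub_proj ?gt_eqF.
Qed.

(** Cauchy-Schwarz for the components of [w] and [y] orthogonal to the unit
    vector [x]. *)
Lemma dot_CauchySchwarz_orthogonal x y w : dot x x = 1 ->
  `|dot w y - dot w x * dot x y| ^+ 2 <=
  (dot w w - `|dot w x| ^+ 2) * (dot y y - `|dot x y| ^+ 2).
Proof.
move=> x1; have x0 : dot x x != 0 by rewrite x1 oner_neq0.
have := dot_CauchySchwarz (w - (dot w x / dot x x) *: x)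
                          (y - (dot y x / dot x x) *: x).
rewrite !dnorm_sub_proj// [X in `|X|]linearBr linearZr_LR/=.
rewrite (dot_sub_proj w x0) mulr0 subr0 linearBl/= linearZl_LR/= x1 !divr1.
by rewrite (hermC dot y x) mul1r norm_conjC.
Qed.

End dot_products.

(** * Real-valued norms *)

Section rnorm.
Context {R : realType} {V : normedZmodType R[i]}.
Implicit Types x y : V.

Lemma rnormE x : (rnorm x)%:C%C = `|x|.
Proof. exact: RRe_real (normr_real x). Qed.

Lemma rnorm_ge0 x : 0 <= rnorm x.
Proof. rewrite -lecR rnormE; exact: normr_ge0. Qed.

Lemma ler_rnormD x y : rnorm (x + y) <= rnorm x + rnorm y.
Proof. by rewrite -lecR rmorphD/= !rnormE ler_normD. Qed.

Lemma ler_rnorm_sum (I : Type) (r : seq I) (F : I -> V) :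
  rnorm (\sum_(i <- r) F i) <= \sum_(i <- r) rnorm (F i).
Proof.
rewrite -lecR rmorph_sum/= rnormE (le_trans (ler_norm_sum _ _ _))//.
by under [leRHS]eq_bigr do rewrite rnormE.
Qed.

End rnorm.

Lemma rnormM {R : realType} (a b : R[i]) : rnorm (a * b) = rnorm a * rnorm b.
Proof. by apply: complexI; rewrite rmorphM/= !rnormE normrM. Qed.

(** This is the weight that [rnorm_dot_operator_sqr_le] puts on the squared
    operator norm. *)
Lemma opnorm_weight_ge0 {R : realType} (q : R) : 0 <= q -> q <= 1 ->
  0 <= 1 - q ^+ 2 + q * Num.sqrt (1 - q ^+ 2).
Proof.
by move=> q0 q1; rewrite addr_ge0 ?mulr_ge0 ?sqrtr_ge0// subr_ge0 expr_le1.
Qed.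

(** * Bounds on one operator *)

Section hilbert.
Context {R : realType} {H : completeNormedModType R[i]}.
Context (dot : {dot H for Num.conj}) (hdot : induces_norm dot).
Implicit Types x y w : H.

Lemma rnorm_dot_le w x : rnorm (dot w x) <= rnorm w * rnorm x.
Proof.
have := dot_CauchySchwarz dot w x; rewrite !hdot -exprMn.
rewrite ler_sqr ?nnegrE ?mulr_ge0// => le_wx.
by rewrite -lecR rmorphM/= !rnormE.
Qed.

Lemma rnorm_dot_CauchySchwarz_orthogonal w x y : rnorm x = 1 -> rnorm y = 1 ->
  rnorm (dot w y - dot w x * dot x y) ^+ 2 <=
  (rnorm w ^+ 2 - rnorm (dot w x) ^+ 2) * (1 - rnorm (dot x y) ^+ 2).
Proof.
move=> x1 y1; have dot1 z : rnorm z = 1 -> dot z z = 1.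
  by move=> z1; rewrite hdot -rnormE z1 rmorph1 expr1n.
have := dot_CauchySchwarz_orthogonal y w (dot1 _ x1).
rewrite hdot (dot1 _ y1) -!rnormE -(rmorph1 (real_complex R)).
by rewrite -!rmorphXn/= -!rmorphB -rmorphM lecR.
Qed.

(** The vector [w] plays the role of [T x]; the square root on the right is the
    norm of the part of [y] orthogonal to [x]. *)
Lemma rnorm_dot_sqr_le w x y (q := rnorm (dot x y)) :
  rnorm x = 1 -> rnorm y = 1 ->
  rnorm (dot w y) ^+ 2 <= q ^+ 2 * rnorm (dot w x) ^+ 2 +
    (1 - q ^+ 2 + q * Num.sqrt (1 - q ^+ 2)) * rnorm w ^+ 2.
Proof.
move=> x1 y1; set a := rnorm (dot w x).
have q0 : 0 <= q := rnorm_ge0 _.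
have q1 : 0 <= 1 - q ^+ 2.
  rewrite subr_ge0 expr_le1// (le_trans (rnorm_dot_le _ _))//.
  by rewrite x1 y1 mulr1.
have aw : 0 <= rnorm w ^+ 2 - a ^+ 2.
  rewrite subr_ge0 ler_sqr ?nnegrE ?rnorm_ge0//.
  by rewrite (le_trans (rnorm_dot_le _ _))// x1 mulr1.
pose s := Num.sqrt (1 - q ^+ 2).
pose b := Num.sqrt (rnorm w ^+ 2 - a ^+ 2).
have s2 : s ^+ 2 = 1 - q ^+ 2 by rewrite sqr_sqrtr.
have b2 : b ^+ 2 = rnorm w ^+ 2 - a ^+ 2 by rewrite sqr_sqrtr.
have s0 : 0 <= s := sqrtr_ge0 _.
have b0 : 0 <= b := sqrtr_ge0 _.
have a0 : 0 <= a := rnorm_ge0 _.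
have le_c : rnorm (dot w y) <= q * a + s * b.
  rewrite -[dot w y](subrK (dot w x * dot x y)) addrC.
  rewrite (le_trans (ler_rnormD _ _))// rnormM mulrC lerD2l.
  rewrite -ler_sqr ?nnegrE ?mulr_ge0 ?rnorm_ge0//.
  rewrite exprMn s2 b2 [leRHS]mulrC.
  exact: rnorm_dot_CauchySchwarz_orthogonal.
apply: (@le_trans _ _ ((q * a + s * b) ^+ 2)).
  by rewrite ler_sqr ?nnegrE ?rnorm_ge0 ?addr_ge0 ?mulr_ge0.
(* The right-hand side exceeds the square by exactly the sum of the next two
   terms, so that the final inequality is linear in them. *)
have ab : 0 <= q * s * (a - b) ^+ 2 := mulr_ge0 (mulr_ge0 q0 s0) (sqr_ge0 _).
have sa : 0 <= s ^+ 2 * a ^+ 2 := mulr_ge0 (sqr_ge0 _) (sqr_ge0 _).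
rewrite -/s -s2 (_ : rnorm w ^+ 2 = b ^+ 2 + a ^+ 2); last by rewrite b2 subrK.
nra.
Qed.

(** Boundedness of [T] matters because the supremum of an unbounded set is a
    default value. *)
Lemma opnorm_ge (T : H -> H) x :
  bounded_operator T -> rnorm x <= 1 -> rnorm (T x) <= opnorm T.
Proof.
move=> [M TM] x1; apply: ub_le_sup; last by exists x.
exists `|M| => _ [z z1 <-]; rewrite (le_trans (TM z))//.
rewrite (le_trans (ler_norm _))// normrM ler_piMr//.
by rewrite ger0_norm// rnorm_ge0.
Qed.

Lemma numerical_radius_ge (T : H -> H) x : bounded_operator T ->
  rnorm x = 1 -> rnorm (dot (T x) x) <= numerical_radius dot T.
Proof.
move=> bT x1; apply: ub_le_sup; last by exists x.
exists (opnorm T) => _ [z z1 <-]; rewrite (le_trans (rnorm_dot_le _ _))//.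
by rewrite z1 mulr1 opnorm_ge// z1.
Qed.

Lemma rnorm_dot_operator_sqr_le (T : H -> H) x y (q := rnorm (dot x y)) :
  bounded_operator T -> rnorm x = 1 -> rnorm y = 1 ->
  rnorm (dot (T x) y) ^+ 2 <= q ^+ 2 * numerical_radius dot T ^+ 2 +
    (1 - q ^+ 2 + q * Num.sqrt (1 - q ^+ 2)) * opnorm T ^+ 2.
Proof.
move=> bT x1 y1; rewrite (le_trans (rnorm_dot_sqr_le _ x1 y1))// -/q.
have q0 : 0 <= q := rnorm_ge0 _.
have q1 : q <= 1 by rewrite (le_trans (rnorm_dot_le _ _))// x1 y1 mulr1.
have wT := numerical_radius_ge bT x1.
have nT : rnorm (T x) <= opnorm T by rewrite opnorm_ge// x1.
have sqr_le (u v : R) : 0 <= u -> u <= v -> u ^+ 2 <= v ^+ 2.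
  by move=> u0 uv; rewrite lerXn2r// nnegrE// (le_trans u0).
apply: lerD; apply: ler_wpM2l; rewrite ?sqr_ge0 ?sqr_le ?rnorm_ge0//.
by rewrite opnorm_weight_ge0.
Qed.

End hilbert.

(** * Jensen's inequality for arithmetic means *)

Section jensen.
Context {R : realFieldType}.

Lemma jensen_mean (D : set R) (f : R -> R) n (c : 'I_n.+1 -> R) :
  convex_set (D : set (convex_lmodType R^o)) ->
  convex_function (D : set (convex_lmodType R^o)) f ->
  (forall i, D (c i)) ->
  f (n.+1%:R^-1 * \sum_i c i) <= n.+1%:R^-1 * \sum_i f (c i).
Proof.
move=> cD cf Dc.
(* The induction needs the partial means to stay in the domain of convexity. *)
suff [] : D (n.+1%:R^-1 * \sum_i c i) /\
  f (n.+1%:R^-1 * \sum_i c i) <= n.+1%:R^-1 * \sum_i f (c i) by [].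
elim: n c Dc => [|n IHn] c Dc.
  by rewrite !big_ord1 invr1 !mul1r.
have [Dm fm] := IHn _ (fun i => Dc (widen_ord (leqnSn _) i)).
have t0 : 0 <= (n.+2%:R^-1 : R) by rewrite invr_ge0.
have t1 : (n.+2%:R^-1 : R) <= 1 by rewrite invf_le1// ler1n.
pose t : {i01 R} := Itv01 t0 t1.
pose avg (a b : R) := t%:num * a + (1 - t%:num) * b.
have mean_recr (g : R -> R) : n.+2%:R^-1 * \sum_i g (c i) =
    avg (g (c ord_max))
      (n.+1%:R^-1 * \sum_i g (c (widen_ord (leqnSn _) i))).
  rewrite /avg /= big_ord_recr/=; set S := \sum_i _.
  rewrite mulrDr addrC; congr (_ + _).
  by field; rewrite nat1r -natrD !pnatr_eq0.
have avg_in a b : D a -> D b -> D (avg a b).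
  by move=> /mem_set Da /mem_set Db; apply/set_mem/(cD a b t).
have avg_le a b : D a -> D b -> f (avg a b) <= avg (f a) (f b).
  by move=> /mem_set Da /mem_set Db; apply: (cf t).
rewrite (mean_recr id) (mean_recr f); split; first exact: avg_in.
by apply: le_trans (avg_le _ _ _ _) _; rewrite // lerD2l ler_wpM2l// subr_ge0.
Qed.

(** Jensen's inequality for the square; multiplied by [n.+1 ^ 2] it is the
    Cauchy-Schwarz inequality against the constant vector. *)
Lemma sqr_mean_le n (c : 'I_n.+1 -> R) :
  (n.+1%:R^-1 * \sum_i c i) ^+ 2 <= n.+1%:R^-1 * \sum_i c i ^+ 2.
Proof.
have sqr_conv (t x y : R) : 0 <= t -> t <= 1 ->
    (t * x + (1 - t) * y) ^+ 2 <= t * x ^+ 2 + (1 - t) * y ^+ 2.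
  move=> t0; rewrite -subr_ge0 => t1.
  (* The difference of the two sides is [t * (1 - t) * (x - y) ^+ 2]. *)
  have := mulr_ge0 (mulr_ge0 t0 t1) (sqr_ge0 (x - y)); nra.
apply: (@jensen_mean setT (fun x => x ^+ 2)) => [x y t _ _|t x y _ _|//].
  exact: mem_set.
exact: sqr_conv (ge0 t) (le1 t).
Qed.

End jensen.

Lemma convex_set_itv0y (R : realFieldType) :
  convex_set (`[0, +oo[%classic : set (convex_lmodType R^o)).
Proof.
move=> x y t; rewrite !in_setE/= !in_itv/= !andbT => x0 y0.
by apply: addr_ge0; apply: mulr_ge0 => //; rewrite subr_ge0 le1.
Qed.

(** * The inequality for sums of operators *)

Theorem theorem1p2 (R : realType) (H : completeNormedModType R[i])
    (dot : {dot H for Num.conj}) (hdot : induces_norm dot)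
    (n : nat) (hn : (0 < n)%N)
    (T : 'I_n -> {linear H -> H}) (hT : forall i, bounded_operator (T i))
    (q : R[i]) (hq : rnorm q <= 1)
    (hne : q_values dot q (fun x => \sum_(i < n) T i x) !=set0)
    (phi : R -> R) (hphi : orlicz phi) :
  phi (q_numerical_radius dot q (fun x => \sum_(i < n) T i x) ^+ 2) <=
  n%:R^-1 * \sum_(i < n)
    phi (n%:R ^+ 2 *
         (rnorm q ^+ 2 * numerical_radius dot (T i) ^+ 2 +
          (1 - rnorm q ^+ 2 + rnorm q * Num.sqrt (1 - rnorm q ^+ 2)) *
          opnorm (T i) ^+ 2)).
Proof.
case: n hn T hT hne => // n _ T hT hne.
set C := fun i => rnorm q ^+ 2 * numerical_radius dot (T i) ^+ 2 +
  (1 - rnorm q ^+ 2 + rnorm q * Num.sqrt (1 - rnorm q ^+ 2)) *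
  opnorm (T i) ^+ 2.
have C0 i : 0 <= C i.
  apply: addr_ge0; apply: mulr_ge0; rewrite ?sqr_ge0//.
  by rewrite opnorm_weight_ge0 ?rnorm_ge0.
pose M := n.+1%:R^-1 * \sum_i (n.+1%:R ^+ 2 * C i).
have M0 : 0 <= M.
  by rewrite mulr_ge0 ?invr_ge0// sumr_ge0// => i _; rewrite mulr_ge0 ?sqr_ge0.
have dot_le v : q_values dot q (fun x => \sum_i T i x) v ->
    0 <= v <= Num.sqrt M.
  move=> [[x y] /= [x1 y1 xyq] <-]; rewrite rnorm_ge0/=.
  rewrite -[leLHS]ger0_norm ?rnorm_ge0// -sqrtr_sqr ler_sqrt//.
  rewrite linear_sumlz.
  apply: (@le_trans _ _ ((\sum_i rnorm (dot (T i x) y)) ^+ 2)).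
    rewrite ler_sqr ?nnegrE ?rnorm_ge0 ?sumr_ge0 ?ler_rnorm_sum// => i _.
    exact: rnorm_ge0.
  set a := fun i => rnorm (dot (T i x) y).
  (* Scaling each term by [n.+1] turns the sum into a mean, which is where the
     factor [n.+1 ^ 2] comes from. *)
  apply: (@le_trans _ _ (n.+1%:R^-1 * \sum_i (n.+1%:R ^+ 2 * a i ^+ 2))).
    have := sqr_mean_le (fun i => n.+1%:R * a i).
    have -> : n.+1%:R^-1 * \sum_i (n.+1%:R * a i) = \sum_i a i.
      by rewrite -mulr_sumr mulKf// pnatr_eq0.
    by under [X in _ <= _ * X]eq_bigr do rewrite exprMn.
  rewrite ler_wpM2l ?invr_ge0// ler_sum// => i _; rewrite ler_wpM2l ?sqr_ge0//.
  by rewrite /a /C -xyq rnorm_dot_operator_sqr_le.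
have sup_le : q_numerical_radius dot q (fun x => \sum_i T i x) ^+ 2 <= M.
  rewrite -(sqr_sqrtr M0) lerXn2r ?nnegrE ?sqrtr_ge0//.
    have [v qv] := hne; have /andP[v0 _] := dot_le v qv.
    apply: (le_trans v0); apply: ub_le_sup => //.
    by exists (Num.sqrt M) => u /dot_le/andP[].
  by apply: ge_sup => // v /dot_le/andP[].
apply: (le_trans (orlicz_increasing hphi (sqr_ge0 _) sup_le)).
apply: (jensen_mean (@convex_set_itv0y R) (orlicz_convex hphi)) => i /=.
by rewrite in_itv/= andbT mulr_ge0 ?sqr_ge0.
Qed.
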